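(* Let $\ell$ be a $2$-satisfactory prime, i.e. a prime with $\ell \not\equiv 1 \pmod{12}$, and let $\alpha = \frac{a}{b} \in \mathbb{Q}$ (in lowest terms, $b>0$) with $\ell \nmid b$. If $r \in \mathbb{Z}$ satisfies $\operatorname{ord}_{\ell}(12r+1) = 1$, then for all integers $n$ we have $$p_{\alpha}(\ell^2 n + r) \equiv 0 \pmod{\ell^{\operatorname{ord}_{\ell}(\alpha-2)-1}}.$$
   Context: For $\alpha \in \mathbb{Q}$, the rational numbers $p_\alpha(n)$ are defined by the formal power series identity $\sum_{n=0}^{\infty} p_\alpha(n) q^n = (q;q)_\infty^{\alpha}$, where $(q;q)_\infty = \prod_{n=1}^\infty (1-q^n)$ (the power is the one with constant term $1$), and $p_\alpha(n) := 0$ for $n<0$. Write $\alpha = a/b$ in lowest terms with $b>0$. For a prime $\ell \nmid b$, the numbers $p_\alpha(n)$ are $\ell$-integral (i.e. lie in $\mathbb{Z}_{(\ell)}$). For a prime $\ell$, $\operatorname{ord}_\ell$ denotes the $\ell$-adic valuation on $\mathbb{Q}$ (with $\operatorname{ord}_\ell(0)=+\infty$), and for an $\ell$-integral rational $x$, $x \equiv 0 \pmod{\ell^m}$ means $\operatorname{ord}_\ell(x) \ge m$. *)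

(* Defs.v *)
From mathcomp Require Import all_boot all_order all_algebra.
From mathcomp Require Import constructive_ereal ring.

Set Implicit Arguments.
Unset Strict Implicit.
Unset Printing Implicit Defensive.

Import Order.TTheory GRing.Theory Num.Theory.

Local Open Scope ring_scope.

(* Values in the integers extended by +oo; padic_ord ell 0 = +oo. *)
Definition padic_ord (ell : nat) (x : rat) : \bar int :=
  if x == 0 then +oo%E
  else ((logn ell `|numq x|)%:Z - (logn ell `|denq x|)%:Z)%:E.

(* The exponent m may be +oo, in which case the congruence says x = 0. *)
Definition cong0 (ell : nat) (m : \bar int) (x : rat) : Prop :=
  (m <= padic_ord ell x)%E.

Definition gbinom (alpha : rat) (k : nat) : rat :=
  (\prod_(i < k) (alpha - i%:R)) / (k`!)%:R.

(* (q;q)_oo modulo q^(n+1). *)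
Definition qpoch_trunc (n : nat) : {poly rat} :=
  \prod_(1 <= i < n.+1) (1 - 'X^i).

(* The coefficient of q^n in (q;q)_oo^alpha, the power being the binomial     *)
(* series \sum_k binom(alpha, k) ((q;q)_oo - 1)^k. Since (q;q)_oo - 1 has no  *)
(* constant term, the coefficient of q^n only involves the k <= n and the     *)
(* factors 1 - q^i with i <= n.                                               *)
Definition pnat (alpha : rat) (n : nat) : rat :=
  (\sum_(k < n.+1) gbinom alpha k *: (qpoch_trunc n - 1) ^+ k)`_n.

Definition palpha (alpha : rat) (n : int) : rat :=
  if n is Posz m then pnat alpha m else 0.

(* pnat_0, pnat_1 and pnat_D below determine the series \sum_n pnat alpha n   *)
(* q^n for all rational alpha: it is (q;q)_oo at alpha = 1, additive in the   *)
(* exponent, and has constant term 1.                                         *)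
Lemma pnat_0 (alpha : rat) : pnat alpha 0 = 1.
Proof.
rewrite /pnat big_ord_recl big_ord0 addr0 expr0 /gbinom big_ord0 fact0 divr1.
by rewrite scale1r coef1.
Qed.

Lemma pnat_1 (n : nat) : pnat 1 n = (qpoch_trunc n)`_n.
Proof.
have g0 : gbinom 1 0 = 1 by rewrite /gbinom big_ord0 fact0 divr1.
have g1 : gbinom 1 1 = 1.
  by rewrite /gbinom big_ord_recl big_ord0 subr0 mulr1.
case: n => [|n].
  by rewrite pnat_0 /qpoch_trunc big_geq // coef1.
rewrite /pnat !big_ord_recl /= big1 => [|i _].
  by rewrite g0 g1 !scale1r expr0 expr1 addr0 addrC subrK.
rewrite /gbinom !big_ord_recl /= subrr.
by rewrite !(mul0r, mulr0) scale0r.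
Qed.

Lemma gbinomS (a : rat) k : k.+1%:R * gbinom a k.+1 = (a - k%:R) * gbinom a k.
Proof.
rewrite /gbinom big_ord_recr /= factS natrM.
have h1 : k.+1%:R != 0 :> rat by rewrite pnatr_eq0.
have h2 : k`!%:R != 0 :> rat by rewrite pnatr_eq0 -lt0n fact_gt0.
move: h1 h2; move: (k.+1%:R) (k`!%:R) => x y h1 h2.
by field; rewrite h1 h2.
Qed.

Lemma gbinomD (a b : rat) k :
  gbinom (a + b) k = \sum_(j < k.+1) gbinom a j * gbinom b (k - j)%N.
Proof.
elim: k => [|k IHk].
  by rewrite big_ord_recl big_ord0 addr0 /gbinom !big_ord0 fact0 !divr1.
have h1 : k.+1%:R != 0 :> rat by rewrite pnatr_eq0.
apply: (mulfI h1); rewrite gbinomS IHk.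
have -> : k.+1%:R * (\sum_(j < k.+2) gbinom a j * gbinom b (k.+1 - j)%N) =
    \sum_(j < k.+2) (j%:R * gbinom a j) * gbinom b (k.+1 - j)%N +
    \sum_(j < k.+2) gbinom a j * ((k.+1 - j)%N%:R * gbinom b (k.+1 - j)%N).
  rewrite mulr_sumr -big_split /=; apply: eq_bigr => j _.
  have -> : k.+1%:R = j%:R + (k.+1 - j)%N%:R :> rat.
    by rewrite -natrD subnKC // -ltnS ltn_ord.
  by ring.
rewrite [X in _ = X + _]big_ord_recl /= !mul0r add0r [X in _ = _ + X]big_ord_recr /= subnn mul0r.
rewrite mulr0 addr0 -big_split /= mulr_sumr; apply: eq_bigr => j _.
have lejk : (j <= k)%N by rewrite -ltnS ltn_ord.
rewrite /bump /= add1n subSS subSn // !gbinomS natrB //.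
by ring.
Qed.

Lemma qpoch_trunc_le n m :
  (n <= m)%N -> exists w : {poly rat}, qpoch_trunc m = qpoch_trunc n + 'X^(n.+1) * w.
Proof.
elim: m => [|m IHm]; first by rewrite leqn0 => /eqP->; exists 0; rewrite mulr0 addr0.
rewrite leq_eqVlt ltnS => /predU1P[->|lenm]; first by exists 0; rewrite mulr0 addr0.
have [w Hw] := IHm lenm.
exists (w - 'X^(m - n) * (qpoch_trunc n + 'X^(n.+1) * w)).
rewrite {1}/qpoch_trunc big_nat_recr //= -/(qpoch_trunc m) Hw.
rewrite -{1}(subnKC lenm) -addSn exprD.
by ring.
Qed.

Lemma coef_qpoch_exp k n m :
  (n <= m)%N -> ((qpoch_trunc m - 1) ^+ k)`_n = ((qpoch_trunc n - 1) ^+ k)`_n.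
Proof.
move=> lenm; have [w ->] := qpoch_trunc_le lenm.
suff [v ->] : exists v : {poly rat}, (qpoch_trunc n + 'X^(n.+1) * w - 1) ^+ k =
    (qpoch_trunc n - 1) ^+ k + 'X^(n.+1) * v.
  by rewrite coefD coefXnM ltnSn addr0.
elim: k => [|k [v IHk]]; first by exists 0; rewrite mulr0 addr0.
exists (w * (qpoch_trunc n - 1) ^+ k + (qpoch_trunc n + 'X^(n.+1) * w - 1) * v).
by rewrite [LHS]exprS IHk [(_ - 1) ^+ k.+1]exprS; ring.
Qed.

Lemma coef_qpoch_exp_gt k n m : (n < k)%N -> ((qpoch_trunc m - 1) ^+ k)`_n = 0.
Proof.
move=> ltnk; have [w ->] := qpoch_trunc_le (leq0n m).
rewrite /qpoch_trunc big_geq // addrAC subrr add0r expr1 exprMn.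
by rewrite coefXnM ltnk.
Qed.

Lemma pnatE alpha n m : (n <= m)%N ->
  pnat alpha n = (\sum_(k < m.+1) gbinom alpha k *: (qpoch_trunc m - 1) ^+ k)`_n.
Proof.
move=> lenm; rewrite /pnat !coef_sum.
rewrite (big_ord_widen m.+1 (fun k : nat =>
  (gbinom alpha k *: (qpoch_trunc n - 1) ^+ k)`_n)) //.
rewrite [RHS](bigID (fun k : 'I_m.+1 => (k < n.+1)%N)) /=.
rewrite [X in _ = _ + X]big1 ?addr0 => [|k].
  by apply: eq_bigr => k _; rewrite !coefZ (@coef_qpoch_exp _ n m).
by rewrite -leqNgt coefZ => /coef_qpoch_exp_gt ->; rewrite mulr0.
Qed.

Lemma pnat_D (alpha beta : rat) (n : nat) :
  pnat (alpha + beta) n = \sum_(i < n.+1) pnat alpha i * pnat beta (n - i)%N.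
Proof.
set u := qpoch_trunc n - 1.
transitivity ((\sum_(k < n.+1) gbinom alpha k *: u ^+ k) *
              (\sum_(k < n.+1) gbinom beta k *: u ^+ k))`_n; last first.
  rewrite coefM; apply: eq_bigr => i _.
  by rewrite (@pnatE _ i n) ?(@pnatE _ (n - i) n) ?leq_subr // -ltnS.
rewrite big_distrlr coef_sum /=.
transitivity (\sum_(k < n.+1) \sum_(j < n.+1 | (j <= k)%N)
    gbinom alpha j * gbinom beta (k - j)%N * (u ^+ k)`_n).
  rewrite /pnat coef_sum; apply: eq_bigr => k _.
  rewrite coefZ gbinomD mulr_suml.
  by rewrite (big_ord_widen n.+1 (fun j : nat =>
    gbinom alpha j * gbinom beta (k - j)%N * (u ^+ k)`_n)).
rewrite (exchange_big_dep xpredT) //=; apply: eq_bigr => j _.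
rewrite coef_sum -(big_mkord (fun k => (j <= k)%N) (fun k =>
  gbinom alpha j * gbinom beta (k - j)%N * (u ^+ k)`_n)).
rewrite -(big_mkord xpredT (fun l =>
  ((gbinom alpha j *: u ^+ j) * (gbinom beta l *: u ^+ l))`_n)).
have lej : (j <= n.+1)%N by apply: ltnW; apply: ltn_ord.
rewrite (big_cat_nat (n := j)) //= big_nat_cond big1 ?add0r; last first.
  by move=> k /andP[/andP[_ ltkj]]; rewrite leqNgt ltkj.
rewrite [RHS](big_cat_nat (n := (n.+1 - j)%N)) //= ?leq_subr //.
rewrite [X in _ = _ + X]big_nat_cond [X in _ = _ + X]big1 ?addr0; last first.
  move=> l /andP[/andP[hl _] _]; rewrite -scalerAl -scalerAr -exprD !coefZ.
  by rewrite coef_qpoch_exp_gt ?mulr0 // -leq_subLR.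
rewrite -{1}[nat_of_ord j]add0n big_addn.
rewrite big_mkcond; apply: eq_bigr => l _.
by rewrite leq_addl addnK -scalerAl -scalerAr -exprD !coefZ mulrA addnC.
Qed.

(* Main.v *)
Require Import Defs.
From mathcomp Require Import all_boot all_order all_algebra all_field.
From mathcomp Require Import constructive_ereal ring zify.

(** Put beta = alpha - 2 and g = (q;q)_oo^beta, so that (q;q)_oo^alpha = g (q;q)_oo^2 and
    p_alpha(N) is the sum of g_i p_2(N - i) over i <= N. For N = ell^2 n + r every term is
    controlled, for one of two reasons.

    If ell^2 divides i, then p_2(N - i) = 0 ([pnat_2_vanish]), because ell divides
    12 (N - i) + 1 exactly once. By the pentagonal number theorem, p_2(M) is the sum of
    chi(x) chi(y) over the representations x^2 + y^2 = 24 M + 2 in natural numbers, where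
    chi is the quadratic character modulo 12 ([pnat_2_sq_pairs]). When ell = 3 mod 4 there
    is no representation. When ell = 5 mod 12, write ell = pi * conj pi in the Gaussian
    integers; exactly one of pi and conj pi divides z = x + i y, and if z = pi w then
    the involution pi w |-> pi * conj w (likewise with conj pi) reverses the sign
    chi(x) chi(y), so the sum is zero. The prime ell cannot be 2 or 3, as it divides
    12 r + 1. In terms of modular forms, eta(12 z)^2 has complex multiplication both by
    Q(i) and by Q(sqrt -3), and these two cases cover the primes inert in one of them.

    If ell^2 does not divide i, then g_i is small: comparing coefficients in
    F g' = beta F' g, where F = (q;q)_oo, shows that i g_i is a multiple of beta in the
    localization at ell ([loc_mult_n_pnat]), hence so is ell g_i.

    Thus ell p_alpha(N) is a multiple of beta = alpha - 2 in the localization at ell, which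
    is the assertion. *)

Set Implicit Arguments.
Unset Strict Implicit.
Unset Printing Implicit Defensive.

Import Order.TTheory GRing.Theory Num.Theory.
Local Open Scope ring_scope.

Local Notation pnat := Defs.pnat.

(** * The pentagonal number theorem *)

(** The quadratic character modulo 12. For x = 6k - 1 or 6k + 1 its value is (-1)^k, the
    sign in the pentagonal number theorem; indexing by x instead of k turns that sign into
    a multiplicative function of x. *)
Definition chi12 (x : nat) : int :=
  let r := (x %% 12)%N in
  if r \in [:: 1; 11]%N then 1 else if r \in [:: 5; 7]%N then -1 else 0.

(** The pentagonal number k(3k - 1)/2 equals ((6k - 1)^2 - 1)/24; the value is meaningful
    only for x prime to 6. *)
Definition pent_exp (x : nat) : nat := ((x ^ 2 - 1) %/ 24)%N.

Lemma chi12_square (x : nat) : chi12 x != 0 -> (x ^ 2 = 24 * pent_exp x + 1)%N.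
Proof.
move=> chix; rewrite /pent_exp.
have: (x %% 12 \in [:: 1; 5; 7; 11])%N.
  by move: chix; rewrite /chi12 !inE; do ![case: eqP => //=].
rewrite {2 3}(divn_eq x 12); move: (x %/ 12)%N (x %% 12)%N => q r.
rewrite !inE => /or4P[] /eqP->.
- have -> : ((q * 12 + 1) ^ 2 - 1 = (6 * q * q + q) * 24)%N by rewrite expnS expn1; nia.
  rewrite mulnK //; nia.
- have -> : ((q * 12 + 5) ^ 2 - 1 = (6 * q * q + 5 * q + 1) * 24)%N by nia.
  rewrite mulnK //; nia.
- have -> : ((q * 12 + 7) ^ 2 - 1 = (6 * q * q + 7 * q + 2) * 24)%N by nia.
  rewrite mulnK //; nia.
have -> : ((q * 12 + 11) ^ 2 - 1 = (6 * q * q + 11 * q + 5) * 24)%N by nia.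
rewrite mulnK //; nia.
Qed.

Definition pent_sum (m : nat) : {poly rat} :=
  \sum_(0 <= x < m) (chi12 x)%:~R *: 'X^(pent_exp x).

(** Among six consecutive x only two are prime to 6. With m = n + 1, the exponents
    are written as m^2 + m(m - 1)/2 and m^2 + m(m + 1)/2, which is the form that the
    telescoping sum [shanks_partial] produces. *)
Lemma pent_sum_step (n : nat) :
  pent_sum (6 * n.+1 + 2) = pent_sum (6 * n + 2) +
    (-1) ^+ n.+1 *: ('X^(n.+1 ^ 2 + 'C(n.+1, 2)) + 'X^(n.+1 ^ 2 + 'C(n.+2, 2))).
Proof.
rewrite /pent_sum.
have -> : (6 * n.+1 + 2 = (6 * n + 2).+4.+2)%N by lia.
do 6![rewrite big_nat_recr //=].
have modE k : ((6 * n + k) %% 12 = (6 * odd n + k) %% 12)%N.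
  by have := odd_double_half n; case: (odd n) => /= ?; lia.
have chiE k : chi12 (6 * n + k) = chi12 (6 * odd n + k) by rewrite /chi12 modE.
have binE k : ('C(k.+1, 2) * 2 = k * k.+1)%N.
  by have := mul_bin_diag k.+1 1; rewrite bin1 /=; lia.
rewrite -!addnS !chiE.
have e5 : pent_exp (6 * n + 5) = (n.+1 ^ 2 + 'C(n.+1, 2))%N.
  have := binE n; rewrite /pent_exp; move: 'C(_, _) => b hb.
  suff -> : ((6 * n + 5) ^ 2 - 1 = (n.+1 ^ 2 + b) * 24)%N by rewrite mulnK.
  nia.
have e7 : pent_exp (6 * n + 7) = (n.+1 ^ 2 + 'C(n.+2, 2))%N.
  have := binE n.+1; rewrite /pent_exp; move: 'C(_, _) => b hb.
  suff -> : ((6 * n + 7) ^ 2 - 1 = (n.+1 ^ 2 + b) * 24)%N by rewrite mulnK.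
  nia.
rewrite e5 e7 exprS -signr_odd.
case: (odd n); rewrite /chi12 /= !scale0r ?addr0 ?expr0 ?expr1.
  by rewrite mulrNN mulr1 !scale1r -!addrA.
by rewrite mulr1 !scaleN1r -addrA opprD.
Qed.

(** The quotient P_n / P_s of two partial products of (q;q)_oo. *)
Definition qpoch_ratio (s n : nat) : {poly rat} := \prod_(s.+1 <= i < n.+1) (1 - 'X^i).

Definition shanks_term (n s : nat) : {poly rat} :=
  (-1) ^+ s *: (qpoch_ratio s n * 'X^(s * n + 'C(s.+1, 2))).

Lemma qpoch_ratio_recr s n : (s <= n)%N ->
  qpoch_ratio s n.+1 = qpoch_ratio s n * (1 - 'X^(n.+1)).
Proof. by move=> le_sn; rewrite /qpoch_ratio big_nat_recr. Qed.

Lemma qpoch_ratio_recl s n : (s < n)%N ->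
  qpoch_ratio s n = (1 - 'X^(s.+1)) * qpoch_ratio s.+1 n.
Proof. by move=> lt_sn; rewrite /qpoch_ratio big_ltn. Qed.

Lemma qpoch_ratio_id s : qpoch_ratio s s = 1.
Proof. by rewrite /qpoch_ratio big_geq. Qed.

(** Telescoping: in the difference of the s-th terms for n + 1 and n, split
    q^s (1 - q^(n+1)) - 1 as - (1 - q^s) - q^(n+1+s). The factor 1 - q^s turns P_n / P_s
    into P_n / P_(s-1), so the first part cancels the second part of the term s - 1. *)
Lemma shanks_partial n t : (t <= n)%N ->
  \sum_(0 <= s < t.+1) (shanks_term n.+1 s - shanks_term n s) =
  - (-1) ^+ t *: (qpoch_ratio t n * 'X^(t * n.+1 + n.+1 + 'C(t.+1, 2))).
Proof.
elim: t => [|t IH] le_tn.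
  rewrite big_nat1 /shanks_term !expr0 scaleN1r !scale1r /= !mul0n !addn0 ?expr0.
  by rewrite !mulr1 qpoch_ratio_recr // add0n; ring.
rewrite big_nat_recr //= IH 1?ltnW // (qpoch_ratio_recl le_tn) /shanks_term.
rewrite (qpoch_ratio_recr le_tn) (exprS (-1)).
rewrite [('C(t.+2, 2))]binS bin1.
have -> : (t * n.+1 + n.+1 + 'C(t.+1, 2) = t.+1 * n + ('C(t.+1, 2) + t.+1))%N by lia.
have -> : (t.+1 * n.+1 + ('C(t.+1, 2) + t.+1) =
    t.+1 * n + ('C(t.+1, 2) + t.+1) + t.+1)%N by lia.
have -> : (t.+1 * n.+1 + n.+1 + ('C(t.+1, 2) + t.+1) =
    t.+1 * n + ('C(t.+1, 2) + t.+1) + t.+1 + n.+1)%N by lia.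
rewrite !mulN1r !opprK !(exprD 'X _ t.+1) !(exprD 'X _ n.+1) -!mul_polyC !rmorphN !rmorphXn /=.
by rewrite !(exprD 'X _ t.+1); ring.
Qed.

(** Shanks' finite form of Euler's pentagonal number theorem: a polynomial identity, proved
    by induction on n, whose s = 0 term is the partial product P_n. *)
Lemma shanks_identity n :
  \sum_(0 <= s < n.+1) shanks_term n s = pent_sum (6 * n + 2).
Proof.
elim: n => [|n IH].
  rewrite big_nat1 /shanks_term /pent_sum big_nat_recr //= big_nat1.
  by rewrite qpoch_ratio_id /chi12 /pent_exp /= scale0r add0r !scale1r mulr1.
rewrite pent_sum_step -IH big_nat_recr //=.
have := shanks_partial (leqnn n); rewrite big_split /= sumrN => /eqP.
rewrite subr_eq => /eqP ->; rewrite /shanks_term !qpoch_ratio_id !mul1r.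
have -> : (n * n.+1 + n.+1 + 'C(n.+1, 2) = n.+1 ^ 2 + 'C(n.+1, 2))%N by lia.
have -> : (n.+1 * n.+1 = n.+1 ^ 2)%N by lia.
by rewrite [in RHS]scalerDr exprS mulN1r; ring.
Qed.

(** In [shanks_identity] every term with s > 0 is divisible by q^(n+1). *)
Lemma pentagonal_number n i : (i <= n)%N ->
  (qpoch_trunc n)`_i = (pent_sum (6 * n + 2))`_i.
Proof.
move=> le_in; rewrite -shanks_identity big_ltn //= coefD.
rewrite {1}/shanks_term mul0n scale1r mulr1 -/(qpoch_trunc n) coef_sum big_nat big1 ?addr0 //.
move=> s /andP[s_gt0 _]; rewrite coefZ coefMXn ifT ?mulr0 //.
rewrite -[s]prednK // binS bin1; nia.
Qed.

(** * The square of the Euler product and sums of two squares *)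

Lemma pnat_1_pent N i : (i <= N)%N -> pnat 1 i = (pent_sum (6 * N + 2))`_i.
Proof.
move=> le_iN; rewrite Defs.pnat_1 -(pentagonal_number le_iN).
have := coef_qpoch_exp 1 le_iN; rewrite !expr1 !coefB.
by move/addIr.
Qed.

(** By squares, x^2 + y^2 = 24 N + 2 forces x, y < 6 N + 2, so this finite box contains all
    representations of 24 N + 2. *)
Definition sq_pairs (N : nat) : seq (nat * nat) :=
  [seq z <- [seq (x, y) | x <- iota 0 (6 * N + 2), y <- iota 0 (6 * N + 2)]
     | z.1 ^ 2 + z.2 ^ 2 == 24 * N + 2]%N.

Lemma mem_sq_pairs N x y :
  ((x, y) \in sq_pairs N) = (x ^ 2 + y ^ 2 == 24 * N + 2)%N.
Proof.
rewrite mem_filter /=; case: eqP => //= eqN.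
by apply/allpairsP; exists (x, y); rewrite /= !mem_iota; split=> //; nia.
Qed.

Lemma mem_sq_pairs_absz N (x y : int) :
  ((`|x|%N, `|y|%N) \in sq_pairs N) = (x ^+ 2 + y ^+ 2 == (24 * N + 2)%N%:Z).
Proof.
rewrite mem_sq_pairs -eqz_nat PoszD -!mulnn !PoszM !abszE -!expr2.
by rewrite !real_normK ?num_real.
Qed.

Lemma uniq_sq_pairs N : uniq (sq_pairs N).
Proof.
by rewrite filter_uniq // allpairs_uniq ?iota_uniq // => -[? ?] [? ?] _ _ [-> ->].
Qed.

(** Multiply two copies of the pentagonal series: the exponents (x^2 - 1)/24 and
    (y^2 - 1)/24 add up to N exactly when x^2 + y^2 = 24 N + 2. *)
Lemma pnat_2_sq_pairs N :
  pnat 2 N = (\sum_(z <- sq_pairs N) chi12 z.1 * chi12 z.2)%:~R.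
Proof.
have -> : 2 = 1 + 1 :> rat by [].
rewrite Defs.pnat_D.
transitivity ((pent_sum (6 * N + 2) * pent_sum (6 * N + 2))`_N).
  rewrite coefM; apply: eq_bigr => i _.
  by rewrite (pnat_1_pent (N := N)) ?(pnat_1_pent (N := N)) ?leq_subr // -ltnS.
rewrite /pent_sum big_distrlr coef_sum /= /sq_pairs big_filter [in RHS]big_mkcond.
rewrite big_allpairs_dep rmorph_sum /= /index_iota subn0; apply: eq_bigr => x _.
rewrite coef_sum rmorph_sum; apply: eq_bigr => y _.
rewrite -scalerAl -scalerAr scalerA -exprD coefZ coefXn -intrM /=.
have [->|nzx] := eqVneq (chi12 x) 0; first by rewrite mul0r mul0r if_same.
have [->|nzy] := eqVneq (chi12 y) 0; first by rewrite mulr0 mul0r if_same.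
rewrite (chi12_square nzx) (chi12_square nzy).
have -> : (24 * pent_exp x + 1 + (24 * pent_exp y + 1) == 24 * N + 2)%N =
  (N == pent_exp x + pent_exp y)%N by lia.
by case: eqP => _; rewrite ?mulr1 ?mulr0.
Qed.

(** * Two squares modulo a prime *)

Lemma Fp_expf_pred (p : nat) (x : 'F_p) : prime p -> x != 0 -> x ^+ p.-1 = 1.
Proof.
move=> pr_p nz_x; apply: (mulfI nz_x); rewrite mulr1 -exprS prednK ?prime_gt0 //.
by have := expf_card x; rewrite card_Fp.
Qed.

Lemma Fp_nat_eq0 (p n : nat) : prime p -> (n%:R == 0 :> 'F_p) = (p %| n)%N.
Proof. by move=> pr_p; rewrite (GRing.dvdn_pcharf (pchar_Fp pr_p)). Qed.

(** X^((p-1)/2) - 1 has too few roots to vanish at every nonzero residue. A residue y where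
    it does not vanish has y^((p-1)/2) = -1, and the exponent is even. *)
Lemma sqrtN1_mod_prime p : prime p -> p = 1 %[mod 4] -> exists u, (p %| u ^ 2 + 1)%N.
Proof.
move=> pr_p p1mod4; set k := (p %/ 4)%N.
have p_gt1 := prime_gt1 pr_p.
have pE : p = (4 * k).+1 by have := divn_eq p 4; rewrite p1mod4 -/k; lia.
have k_gt0 : (0 < k)%N by lia.
have [/forall_inP all1|] := boolP [forall (x : 'F_p | x != 0), x ^+ (k * 2) == 1].
  have sz : size ('X^(k * 2) - 1 : {poly 'F_p}) = (k * 2).+1.
    by rewrite size_XnsubC // muln_gt0 k_gt0.
  have nz : ('X^(k * 2) - 1 : {poly 'F_p}) != 0 by rewrite -size_poly_gt0 sz.
  have all_roots : all (root ('X^(k * 2) - 1)) (enum [pred x : 'F_p | x != 0]).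
    apply/allP => x; rewrite mem_enum inE => /all1 /eqP xk.
    by rewrite rootE !hornerE xk subrr.
  have := max_poly_roots nz all_roots (enum_uniq _).
  by rewrite -cardE cardC1 card_Fp // sz => ?; lia.
case/forall_inPn => y nz_y yk.
have : (y ^+ (k * 2)) ^+ 2 = 1.
  by rewrite -exprM -(Fp_expf_pred pr_p nz_y); congr (_ ^+ _); lia.
move/eqP; rewrite sqrf_eq1 (negbTE yk) /= => /eqP yk'.
exists (val (y ^+ k)); rewrite -Fp_nat_eq0 // natrD natrX natr_Zp -exprM yk'.
by rewrite addNr.
Qed.

(** Fermat's theorem by Thue's argument: with u^2 = -1, the pigeonhole principle gives a
    nonzero pair (a, b) of size at most sqrt p with a + u b = 0 modulo p. Then p divides
    a^2 + b^2, which is less than 2 p. *)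
Lemma prime_sum_two_squares p : prime p -> p = 1 %[mod 4] ->
  exists a b : nat, p = (a ^ 2 + b ^ 2)%N.
Proof.
move=> pr_p /(sqrtN1_mod_prime pr_p)[u p_dvd].
have p_gt0 := prime_gt0 pr_p.
have [k lekp ltpk] : exists2 k, (k ^ 2 <= p)%N & (p < k.+1 ^ 2)%N.
  have ex : exists k, (k ^ 2 <= p)%N by exists 0%N.
  have bnd i : (i ^ 2 <= p)%N -> (i <= p)%N by nia.
  case: (ex_maxnP ex bnd) => k hk maxk; exists k => //.
  by rewrite ltnNge; apply/negP => /maxk; rewrite ltnn.
pose f (z : 'I_k.+1 * 'I_k.+1) : 'I_p :=
  Ordinal (ltn_pmod (z.1 + u * z.2) p_gt0).
have /injectivePn[[x1 y1] [[x2 y2] neq /(congr1 val) /= eqf]] : ~~ injectiveb f.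
  apply/negP => /injectiveP /leq_card; rewrite card_prod !card_ord.
  by rewrite leqNgt mulnn ltpk.
have {neq} : (x1 : nat, y1 : nat) != (x2 : nat, y2 : nat) by [].
have := (ltn_ord x1, ltn_ord x2, ltn_ord y1, ltn_ord y2).
move: (x1 : nat) (x2 : nat) (y1 : nat) (y2 : nat) eqf.
move=> {f x1 x2 y1 y2} x1 x2 y1 y2 eqf [[[hx1 hx2] hy1] hy2] neq.
have [a aE] : exists a : int, a = x1%:Z - x2%:Z by eexists.
have [b bE] : exists b : int, b = y1%:Z - y2%:Z by eexists.
have pab : (p%:Z %| a + u%:Z * b)%Z.
  have : ((x1 + u * y1)%N = (x2 + u * y2)%N %[mod p])%Z by rewrite !modz_nat eqf.
  move/eqP; rewrite eqz_mod_dvd; congr (_ %| _)%Z.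
  by rewrite aE bE !PoszD !PoszM; ring.
have pab2 : (p%:Z %| a ^+ 2 + b ^+ 2)%Z.
  have -> : a ^+ 2 + b ^+ 2 = (a + u%:Z * b) * (a - u%:Z * b) + b ^+ 2 * (u ^ 2 + 1)%N%:Z.
    by rewrite PoszD -mulnn PoszM; ring.
  by rewrite rpredD //; [apply: dvdz_mulr | apply: dvdz_mull].
have sq_gt0 : 0 < a ^+ 2 + b ^+ 2.
  rewrite lt0r paddr_eq0 ?sqr_ge0 // !sqrf_eq0 addr_ge0 ?sqr_ge0 // andbT.
  apply: contra neq; rewrite aE bE !subr_eq0 !eqz_nat => /andP[/eqP-> /eqP->].
  exact: eqxx.
have bound : a ^+ 2 + b ^+ 2 < 2 * p%:Z.
  have sq_le (m : int) : - k%:Z <= m -> m <= k%:Z -> m ^+ 2 <= k%:Z ^+ 2.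
    move=> lekm lemk; rewrite -subr_ge0 subr_sqr mulr_ge0 ?subr_ge0 //.
    by rewrite -lerBlDl sub0r.
  have ha : a ^+ 2 <= k%:Z ^+ 2.
    by apply: sq_le; rewrite aE; move: hx1 hx2; clear; lia.
  have hb : b ^+ 2 <= k%:Z ^+ 2.
    by apply: sq_le; rewrite bE; move: hy1 hy2; clear; lia.
  have ltkp : (k * k < p)%N.
    rewrite ltn_neqAle mulnn lekp andbT; apply/eqP => kp.
    case/primeP: pr_p => p_gt1 /(_ k); rewrite -kp dvdn_mulr // => /(_ isT).
    by move=> /orP[] /eqP k1; move: p_gt1; rewrite -kp; move: k1; clear; nia.
  have : k%:Z ^+ 2 < p%:Z by rewrite expr2 -PoszM ltz_nat.
  by move: ha hb; move: (a ^+ 2) (b ^+ 2) (k%:Z ^+ 2); clear; move=> A B K; lia.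
exists `|a|%N, `|b|%N.
case/dvdzP: pab2 => q eq_q.
have p_pos : 0 < p%:Z by [].
have q1 : q = 1.
  by move: sq_gt0 bound; rewrite eq_q pmulr_lgt0 // ltr_pM2r //; clear; lia.
apply/eqP; rewrite -eqz_nat PoszD -!mulnn !PoszM !abszE -!expr2 !real_normK ?num_real //.
by rewrite eq_q q1 mul1r.
Qed.

(** If x^2 = - y^2 with x nonzero modulo p, raising to the odd power (p - 1)/2 gives
    1 = -1 by Fermat's little theorem. *)
Lemma dvd_sum_two_squares p (x y : nat) : prime p -> p = 3 %[mod 4] ->
  (p %| x ^ 2 + y ^ 2)%N -> (p %| x)%N.
Proof.
move=> pr_p p3mod4; rewrite -!Fp_nat_eq0 // natrD !natrX.
set k := (p %/ 4)%N.
have pE : p = (4 * k).+3 by have := divn_eq p 4; rewrite p3mod4 -/k; lia.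
move: (x%:R : 'F_p) (y%:R : 'F_p) => X Y; rewrite addr_eq0 => /eqP sqX.
apply/negPn/negP => nzX.
have nzY : Y != 0 by apply: contra nzX => /eqP Y0; rewrite -sqrf_eq0 sqX Y0 expr0n oppr0.
have : X ^+ p.-1 = - Y ^+ p.-1.
  have -> : p.-1 = (2 * (2 * k + 1))%N by lia.
  by rewrite exprM sqX -mulN1r exprMn addn1 exprS exprM sqrrN !expr1n mulr1 mulN1r -exprM.
rewrite !Fp_expf_pred // => /eqP; rewrite -subr_eq0 opprK -[1 + 1]/(2%:R : 'F_p) Fp_nat_eq0 //.
by move/dvdn_leq => /(_ isT); lia.
Qed.

(** * Reflections of the representations as a sum of two squares *)

(** The weight is negated by an involution, so the sum equals its own opposite. *)
Lemma sum_antisym (T : eqType) (s : seq T) (w : T -> int) (tau : T -> T) :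
  uniq s -> (forall z, z \in s -> tau z \in s) ->
  (forall z, z \in s -> tau (tau z) = z) ->
  (forall z, z \in s -> w (tau z) = - w z) -> \sum_(z <- s) w z = 0.
Proof.
move=> uniq_s stab inv anti.
have uniq_tau : uniq (map tau s).
  by rewrite map_inj_in_uniq // => x y xs ys eq_t; rewrite -(inv x) // eq_t inv.
have perm_tau : perm_eq (map tau s) s.
  have sub : {subset map tau s <= s} by move=> _ /mapP[z zs ->]; apply: stab.
  by apply: uniq_perm => //; apply: (uniq_min_size uniq_tau sub _).2; rewrite size_map.
have : \sum_(z <- s) w z = - \sum_(z <- s) w z.
  rewrite -{1}(perm_big _ perm_tau) big_map /= -sumrN big_seq [RHS]big_seq.
  by apply: eq_bigr => z /anti.
lia.
Qed.

Lemma Euclid_dvdzM (p : nat) (x y : int) : prime p ->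
  (p%:Z %| x * y)%Z = (p%:Z %| x)%Z || (p%:Z %| y)%Z.
Proof. by move=> pr_p; rewrite !dvdzE abszM Euclid_dvdM. Qed.

Lemma absz_signM (x : int) : exists s : int, (s = 1 \/ s = -1) /\ `|x|%N%:Z = s * x.
Proof.
have [x_ge0|x_lt0] := lerP 0 x.
  by exists 1; split; [left | rewrite mul1r gez0_abs].
by exists (-1); split; [right | rewrite mulN1r ltz0_abs].
Qed.

(** Let p = pi * conj pi in the Gaussian integers, c + i d = pi^2 and z = x + i y. If pi
    divides z, say z = pi w, then conj z * pi^2 / p = pi * conj w, whose coordinates are
    (x c + y d) / p and (x d - y c) / p. Otherwise conj pi divides z and takes the place of
    pi, which replaces d by - d. Absolute values keep the result among pairs of naturals. *)
Definition reflect_pair (p : nat) (c d : int) (z : nat * nat) : nat * nat :=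
  let: (x, y) := z in
  let e := if (p%:Z %| x%:Z * c + y%:Z * d)%Z then d else - d in
  (`|(x%:Z * c + y%:Z * e)%R| %/ p, `|(x%:Z * e - y%:Z * c)%R| %/ p)%N.

Section Reflection.
Variables (p : nat) (c d : int).
Hypotheses (pr_p : prime p) (odd_p : (2 < p)%N).
Hypotheses (pNc : ~~ (p%:Z %| c)%Z) (cd : c ^+ 2 + d ^+ 2 = p%:Z ^+ 2).

(** Modulo p, the product of the two numbers is - d^2 (x^2 + y^2): one of pi and conj pi
    divides z. *)
Lemma dvdz_reflect (x y : int) : (p%:Z %| x ^+ 2 + y ^+ 2)%Z ->
  (p%:Z %| x * c + y * d)%Z || (p%:Z %| x * c - y * d)%Z.
Proof.
move=> pxy; rewrite -Euclid_dvdzM //.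
have -> : (x * c + y * d) * (x * c - y * d) =
  x ^+ 2 * p%:Z * p%:Z - d ^+ 2 * (x ^+ 2 + y ^+ 2).
  by rewrite -[_ * p%:Z * _]mulrA -expr2 -cd; ring.
by apply: rpredB; apply: dvdz_mull.
Qed.

(** Applied with y d or - y d as second term: pi and conj pi cannot both divide z, since
    their product p does not. *)
Lemma dvdz_reflect_uniq (x y : int) :
  (p%:Z %| x * c + y)%Z -> (p%:Z %| x * c - y)%Z -> (p%:Z %| x)%Z.
Proof.
move=> h1 h2; have : (p%:Z %| 2 * (x * c))%Z.
  have -> : 2 * (x * c) = (x * c + y) + (x * c - y) by ring.
  by rewrite rpredD.
rewrite !Euclid_dvdzM // (negbTE pNc) orbF => /orP[|//].
by rewrite dvdzE /= => /dvdn_leq => /(_ isT); lia.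
Qed.

(** Changing the sign of one coordinate conjugates z up to sign, and so exchanges the roles
    of pi and conj pi. Hence the map is well defined on pairs taken up to signs. *)
Lemma reflect_pair_abs (x y e : int) :
  e = d \/ e = - d -> (p%:Z %| x ^+ 2 + y ^+ 2)%Z -> ~~ (p%:Z %| x)%Z ->
  (p%:Z %| x * c + y * e)%Z ->
  reflect_pair p c d (`|x|%N, `|y|%N) =
    (`|(x * c + y * e)%R| %/ p, `|(x * e - y * c)%R| %/ p)%N.
Proof.
move=> de pxy pNx pe; rewrite /reflect_pair.
have [[sx [sx1 ax]] [sy [sy1 ay]]] := (absz_signM x, absz_signM y).
set e' := if _ then d else - d.
have pe' : (p%:Z %| `|x|%N%:Z * c + `|y|%N%:Z * e')%Z.
  rewrite /e'; case: ifP => // pNd; rewrite mulrN.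
  have := @dvdz_reflect `|x|%N `|y|%N; rewrite pNd; apply.
  by rewrite ax ay; case: sx1 => ->; case: sy1 => ->; rewrite ?mul1r ?mulN1r ?sqrrN.
have de' : e' = d \/ e' = - d by rewrite /e'; case: ifP; auto.
have eE : e' = sx * sy * e.
  have [//|e'E] : e' = sx * sy * e \/ e' = - (sx * sy * e).
    by case: de' => ->; case: de => ->; case: sx1 => ->; case: sy1 => ->;
       rewrite ?mulNr ?mulrN ?mul1r ?opprK; auto.
  (* The wrong sign would make both Gaussian factors divide the same number. *)
  case/negP: pNx; apply: dvdz_reflect_uniq pe _.
  move: pe'; rewrite ax ay e'E; case: sx1 => ->; case: sy1 => ->.
  - by congr (_ %| _)%Z; ring.
  - by congr (_ %| _)%Z; ring.
  - by rewrite -rpredN; congr (_ %| _)%Z; ring.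
  by rewrite -rpredN; congr (_ %| _)%Z; ring.
rewrite ax ay eE.
have -> : sx * x * c + sy * y * (sx * sy * e) = sx * (x * c + y * e).
  by case: sx1 => ->; case: sy1 => ->; ring.
have -> : sx * x * (sx * sy * e) - sy * y * c = sy * (x * e - y * c).
  by case: sx1 => ->; case: sy1 => ->; ring.
by rewrite !abszM; case: sx1 => ->; case: sy1 => ->; rewrite !mul1n.
Qed.

Lemma reflect_pairP (x y : nat) : (p%:Z %| x%:Z ^+ 2 + y%:Z ^+ 2)%Z ->
  exists X Y e : int, [/\ e = d \/ e = - d, p%:Z * X = x%:Z * c + y%:Z * e,
    p%:Z * Y = x%:Z * e - y%:Z * c, X ^+ 2 + Y ^+ 2 = x%:Z ^+ 2 + y%:Z ^+ 2
    & reflect_pair p c d (x, y) = (`|X|%N, `|Y|%N)].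
Proof.
move=> pxy; rewrite /reflect_pair; set e := if _ then d else - d.
have de : e = d \/ e = - d by rewrite /e; case: ifP; auto.
have ce : c ^+ 2 + e ^+ 2 = p%:Z ^+ 2 by case: de => ->; rewrite ?sqrrN.
have /dvdzP[X XE] : (p%:Z %| x%:Z * c + y%:Z * e)%Z.
  rewrite /e; case: ifP => // pNd; rewrite mulrN.
  by have := dvdz_reflect pxy; rewrite pNd.
move: e de ce XE => e de ce XE.
have normE : (x%:Z * c + y%:Z * e) ^+ 2 + (x%:Z * e - y%:Z * c) ^+ 2 =
    p%:Z ^+ 2 * (x%:Z ^+ 2 + y%:Z ^+ 2) by rewrite -ce; ring.
have /dvdzP[Y YE] : (p%:Z %| x%:Z * e - y%:Z * c)%Z.
  have : (p%:Z %| (x%:Z * e - y%:Z * c) ^+ 2)%Z.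
    have -> : (x%:Z * e - y%:Z * c) ^+ 2 =
        p%:Z * (p%:Z * (x%:Z ^+ 2 + y%:Z ^+ 2) - p%:Z * X ^+ 2).
      by rewrite mulrBr mulrA -expr2 -normE XE; ring.
    exact: dvdz_mulr.
  by rewrite expr2 Euclid_dvdzM // orbb.
have p_neq0 : p%:Z != 0 by rewrite -lt0n prime_gt0.
exists X, Y, e; split=> //; first by rewrite XE mulrC.
- by rewrite YE mulrC.
- apply: (mulfI (expf_neq0 2 p_neq0)); rewrite -normE XE YE; ring.
by rewrite XE YE !abszM !mulnK // prime_gt0.
Qed.

(** The reflection pi w |-> pi * conj w is an involution; only the absolute values need
    [reflect_pair_abs]. *)
Lemma reflect_pairK (x y : nat) (X Y e : int) :
  e = d \/ e = - d -> p%:Z * X = x%:Z * c + y%:Z * e ->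
  p%:Z * Y = x%:Z * e - y%:Z * c -> (p%:Z %| X ^+ 2 + Y ^+ 2)%Z ->
  ~~ (p%:Z %| X)%Z -> reflect_pair p c d (`|X|%N, `|Y|%N) = (x, y).
Proof.
move=> de XE YE pXY pNX.
have ce : c ^+ 2 + e ^+ 2 = p%:Z ^+ 2 by case: de => ->; rewrite ?sqrrN.
have p_neq0 : p%:Z != 0 by rewrite -lt0n prime_gt0.
have xE : X * c + Y * e = x%:Z * p%:Z.
  apply: (mulfI p_neq0); rewrite mulrDr !mulrA XE YE -[p%:Z * _ * _]mulrAC -expr2 -ce; ring.
have yE : X * e - Y * c = y%:Z * p%:Z.
  apply: (mulfI p_neq0); rewrite mulrBr !mulrA XE YE -[p%:Z * _ * _]mulrAC -expr2 -ce; ring.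
rewrite (reflect_pair_abs de) ?xE ?yE ?dvdz_mull //.
by rewrite !abszM !mulnK // prime_gt0.
Qed.

End Reflection.

(** * The sign modulo 12 *)

Lemma all_Z12 (P : pred 'Z_12) : all (fun i => P (inZp i)) (iota 0 12) -> forall x, P x.
Proof.
move=> /allP allP x; have := allP (val x); rewrite valZpK; apply.
by rewrite mem_iota add0n ltn_ord.
Qed.

Lemma all2_Z12 (P : 'Z_12 -> 'Z_12 -> bool) :
  all (fun i => all (fun j => P (inZp i) (inZp j)) (iota 0 12)) (iota 0 12) ->
  forall x y, P x y.
Proof.
move=> allP x; apply: all_Z12; move: x.
exact: (@all_Z12 (fun x => all (fun j => P x (inZp j)) (iota 0 12))).
Qed.

(** The Gaussian square (a + i b)^2, for a^2 + b^2 a prime congruent to 5 modulo 12. *)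
Lemma Z12_pyth (a b : 'Z_12) : a ^+ 2 + b ^+ 2 = 5 ->
  (a ^+ 2 - b ^+ 2 \in [:: 3; -3]) && (2 * a * b \in [:: 4; -4]).
Proof.
move/eqP; apply/implyP; apply: (@all2_Z12 (fun a b => (a ^+ 2 + b ^+ 2 == 5) ==>
  ((a ^+ 2 - b ^+ 2 \in [:: 3; -3]) && (2 * a * b \in [:: 4; -4])))).
by vm_compute.
Qed.

(** The sign change behind the cancellation. The factor 5 is the inverse of p, so the
    arguments on the left are the residues of the image of (x, y) under the reflection. *)
Lemma Z12_sign (x y c e : 'Z_12) : x ^+ 2 + y ^+ 2 = 2 ->
  c \in [:: 3; -3] -> e \in [:: 4; -4] ->
  chi12 (nat_of_ord (5 * (x * c + y * e))) * chi12 (nat_of_ord (5 * (x * e - y * c))) =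
  - (chi12 (nat_of_ord x) * chi12 (nat_of_ord y)).
Proof.
move=> /eqP xy cc ee; apply/eqP; apply: implyP xy.
move: x y; apply: (@all2_Z12 (fun x y => (x ^+ 2 + y ^+ 2 == 2) ==>
  (chi12 (nat_of_ord (5 * (x * c + y * e))) * chi12 (nat_of_ord (5 * (x * e - y * c))) ==
   - (chi12 (nat_of_ord x) * chi12 (nat_of_ord y))))).
by move: cc ee; rewrite !inE => /orP[] /eqP-> /orP[] /eqP->; vm_compute.
Qed.

Lemma chi12_abs (x : int) : chi12 `|x|%N = chi12 (nat_of_ord (x%:~R : 'Z_12)).
Proof.
have chi_nat (n : nat) : chi12 (nat_of_ord (n%:R : 'Z_12)) = chi12 n.
  by rewrite val_Zp_nat // /chi12 modn_mod.
have chi_opp (t : 'Z_12) : chi12 (nat_of_ord t) = chi12 (nat_of_ord (- t)).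
  by apply/eqP; move: t; apply: all_Z12; vm_compute.
have [s [[]-> xE]] := absz_signM x.
  by rewrite mul1r in xE; rewrite -xE -chi_nat.
by rewrite chi_opp -rmorphN -[- x]mulN1r -xE -chi_nat.
Qed.

(** * Vanishing coefficients of the square *)

Section Vanishing.
Variables (p N : nat).
Hypotheses (pr_p : prime p) (pN : (p %| 12 * N + 1)%N) (p2N : ~~ (p ^ 2 %| 12 * N + 1)%N).

Lemma prime_gt3 : (3 < p)%N.
Proof.
case: p pr_p pN => [|[|[|[|[|p']]]]] // _; rewrite /dvdn -modnDml -modnMml //=.
Qed.

Lemma dvd_2norm : (p %| 24 * N + 2)%N /\ ~~ (p ^ 2 %| 24 * N + 2)%N.
Proof.
have -> : (24 * N + 2 = 2 * (12 * N + 1))%N by lia.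
split; first exact: dvdn_mull.
rewrite Gauss_dvdr // coprimeXl // prime_coprime //.
by apply/negP => /dvdn_leq => /(_ isT); have := prime_gt3; lia.
Qed.

Lemma dvd_sq_sum (x y : nat) : (p %| x)%N -> (p %| y)%N -> (p ^ 2 %| x ^ 2 + y ^ 2)%N.
Proof. by move=> px py; rewrite dvdn_add // dvdn_exp2r. Qed.

Lemma sq_pairs_Ndvd x y : (x, y) \in sq_pairs N -> ~~ (p %| x)%N.
Proof.
rewrite mem_sq_pairs => /eqP xyN; apply/negP => px.
have [pxy p2xy] := dvd_2norm; case/negP: p2xy; rewrite -xyN; apply: dvd_sq_sum => //.
by move: pxy; rewrite -xyN (dvdn_addr _ (dvdn_exp (isT : 0 < 2)%N px)) Euclid_dvdX // andbT.
Qed.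

(** There is no representation of 24 N + 2 as a sum of two squares: p would divide both
    coordinates, and p^2 their sum of squares. *)
Lemma pnat_2_vanish_3mod4 : p = 3 %[mod 4] -> pnat 2 N = 0.
Proof.
move=> p3; rewrite pnat_2_sq_pairs big_seq big1 // => -[x y] xyN.
case/negP: (sq_pairs_Ndvd xyN); apply: (dvd_sum_two_squares (y := y)) p3 _ => //.
by move: xyN; rewrite mem_sq_pairs => /eqP->; case: dvd_2norm.
Qed.

(** The reflection permutes the representations of 24 N + 2 and reverses their signs. *)
Lemma pnat_2_vanish_5mod12 : p = 5 %[mod 12] -> pnat 2 N = 0.
Proof.
move=> p5; have p1 : p = 1 %[mod 4] by lia.
have [a [b pE]] := prime_sum_two_squares pr_p p1.
have p_gt3 := prime_gt3.
have pNa : ~~ (p %| a)%N.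
  apply/negP => pa; have pb : (p %| b)%N.
    have := dvdnn p; rewrite {2}pE dvdn_addr ?Euclid_dvdX // ?andbT //.
  have := dvd_sq_sum pa pb; rewrite -pE => /dvdn_leq => /(_ (prime_gt0 pr_p)).
  by move: p_gt3; clear; nia.
pose c := a%:Z ^+ 2 - b%:Z ^+ 2; pose d := 2 * a%:Z * b%:Z.
have pZ : p%:Z = a%:Z ^+ 2 + b%:Z ^+ 2 by rewrite {1}pE PoszD -!mulnn !PoszM.
have cd : c ^+ 2 + d ^+ 2 = p%:Z ^+ 2 by rewrite pZ /c /d; ring.
have p5Z : p%:Z%:~R = 5 :> 'Z_12.
  by apply: val_inj; rewrite /= -pmulrn val_Zp_nat // p5.
have := @Z12_pyth a%:R b%:R; rewrite -!natrX -natrD -pE -p5Z => /(_ erefl) /andP[c12 d12].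
have cZ : c%:~R \in [:: 3; -3 : 'Z_12] by rewrite /c rmorphB !rmorphXn /= -!natrX.
have dZ : d%:~R \in [:: 4; -4 : 'Z_12] by rewrite /d !rmorphM.
have pN2 : ~~ (p%:Z %| 2)%Z by rewrite dvdzE /= gtnNdvd // ltnW.
have pNc : ~~ (p%:Z %| c)%Z.
  apply: contra pN2 => pc.
  have : (p%:Z %| 2 * a%:Z ^+ 2)%Z.
    have -> : 2 * a%:Z ^+ 2 = p%:Z + c by rewrite pZ /c; ring.
    by rewrite rpredD.
  have pNaZ : (p%:Z %| a%:Z)%Z = false by rewrite dvdzE; apply: negbTE.
  by rewrite expr2 !Euclid_dvdzM // pNaZ !orbF.
have dvdS x y : (x, y) \in sq_pairs N -> (p%:Z %| x%:Z ^+ 2 + y%:Z ^+ 2)%Z.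
  rewrite (mem_sq_pairs_absz N x y) => /eqP ->; rewrite dvdzE /=.
  by case: dvd_2norm.
have reflS x y (xyS : (x, y) \in sq_pairs N) :=
  @reflect_pairP p c d pr_p cd x y (dvdS x y xyS).
rewrite pnat_2_sq_pairs (@sum_antisym _ _ _ (reflect_pair p c d)) ?uniq_sq_pairs //.
- move=> [x y] xyS; have [X [Y [e [de XE YE XYE ->]]]] := reflS _ _ xyS.
  by rewrite mem_sq_pairs_absz XYE -(mem_sq_pairs_absz N x y).
- move=> [x y] xyS; have [X [Y [e [de XE YE XYE eqR]]]] := reflS _ _ xyS.
  rewrite eqR; apply: (@reflect_pairK p c d pr_p (ltnW p_gt3) pNc cd x y X Y e de XE YE).
  + by rewrite XYE; apply: dvdS.
  have : (`|X|%N, `|Y|%N) \in sq_pairs N.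
    by rewrite mem_sq_pairs_absz XYE -(mem_sq_pairs_absz N x y).
  by move/sq_pairs_Ndvd.
move=> [x y] xyS; have [X [Y [e [de XE YE _ ->]]]] := reflS _ _ xyS.
rewrite /= !chi12_abs.
have eZ : e%:~R \in [:: 4; -4 : 'Z_12].
  by case: de => ->; rewrite ?rmorphN //; move: dZ; rewrite !inE orbC !eqr_oppLR opprK.
have div5 (t u : int) : p%:Z * t = u -> t%:~R = 5 * u%:~R :> 'Z_12.
  by move=> <-; rewrite intrM p5Z mulrA (_ : 5 * 5 = 1 :> 'Z_12) ?mul1r //; apply: val_inj.
rewrite (div5 _ _ XE) (div5 _ _ YE) rmorphB rmorphD !rmorphM /=.
rewrite Z12_sign // -?chi12_abs //.
have : (x ^ 2 + y ^ 2)%N%:R = (24 * N + 2)%N%:R :> 'Z_12.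
  by move: xyS; rewrite mem_sq_pairs => /eqP ->.
rewrite natrD !natrX natrD natrM (_ : 24%:R = 0 :> 'Z_12) ?mul0r ?add0r //.
exact: val_inj.
Qed.

Lemma pnat_2_vanish : p <> 1 %[mod 12] -> pnat 2 N = 0.
Proof.
move=> pN1; have [p2 p3] : (p %% 2 <> 0 /\ p %% 3 <> 0)%N.
  have p_gt3 := prime_gt3.
  split=> /eqP pd; have := pr_p => /primeP[_ /(_ _ pd)]; rewrite !eqE /=.
    by move: p_gt3; clear; lia.
  by move: p_gt3; clear; lia.
have [p5|p3'] : (p %% 12 = 5 \/ p %% 4 = 3)%N by move: pN1 p2 p3; clear; lia.
  exact: pnat_2_vanish_5mod12.
exact: pnat_2_vanish_3mod4.
Qed.
End Vanishing.

(** * Integrality and divisibility at a prime *)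

(** Membership in the localization of the integers at p. *)
Definition loc_int (p : nat) (x : rat) : Prop :=
  exists d z : int, ~~ (p%:Z %| d)%Z /\ d%:~R * x = z%:~R.

(** Divisibility by b in the localization. Unlike a bound on the valuation it makes sense
    for b = 0, so that the case alpha = 2 needs no separate treatment. *)
Definition loc_mult (p : nat) (b x : rat) : Prop :=
  exists2 y, loc_int p y & x = y * b.

Section LocInt.
Variable (p : nat).
Hypothesis pr_p : prime p.

Lemma loc_int_int (z : int) : loc_int p z%:~R.
Proof.
exists 1, z; split; last by rewrite mul1r.
by rewrite dvdzE /= dvdn1 neq_ltn prime_gt1 ?orbT.
Qed.

Lemma NdvdzM (d e : int) :
  ~~ (p%:Z %| d)%Z -> ~~ (p%:Z %| e)%Z -> ~~ (p%:Z %| d * e)%Z.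
Proof. by rewrite !dvdzE abszM Euclid_dvdM // negb_or => -> ->. Qed.

Lemma loc_intM x y : loc_int p x -> loc_int p y -> loc_int p (x * y).
Proof.
move=> [d [z [pd dx]]] [e [t [pe ey]]]; exists (d * e), (z * t).
by rewrite NdvdzM //; split=> //; rewrite !intrM -dx -ey; ring.
Qed.

Lemma loc_intD x y : loc_int p x -> loc_int p y -> loc_int p (x + y).
Proof.
move=> [d [z [pd dx]]] [e [t [pe ey]]]; exists (d * e), (z * e + t * d).
by rewrite NdvdzM //; split=> //; rewrite intrD !intrM -dx -ey; ring.
Qed.

Lemma loc_intN x : loc_int p x -> loc_int p (- x).
Proof.
by move=> [d [z [pd dx]]]; exists d, (- z); rewrite mulrN dx rmorphN.
Qed.

Lemma loc_int_sum (I : Type) (s : seq I) (P : pred I) (F : I -> rat) :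
  (forall i, P i -> loc_int p (F i)) -> loc_int p (\sum_(i <- s | P i) F i).
Proof. by move=> intF; apply: big_ind => //; [exact: (loc_int_int 0)|exact: loc_intD]. Qed.

Lemma loc_int_div (d : int) x :
  ~~ (p%:Z %| d)%Z -> loc_int p (d%:~R * x) -> loc_int p x.
Proof.
move=> pd [e [t [pe ey]]]; exists (e * d), t.
by rewrite NdvdzM //; split=> //; rewrite intrM -mulrA.
Qed.

Lemma loc_int_denq x : ~~ (p%:Z %| denq x)%Z -> loc_int p x.
Proof.
move=> pN; exists (denq x), (numq x); split=> //.
by rewrite mulrC numqE.
Qed.

(** Modulo p^v there is a natural N with b N = a, and the product becomes b^k times the
    falling factorial of N, a multiple of k! and so of p^v. *)
Lemma dvd_falling (a b : int) (k v : nat) : ~~ (p%:Z %| b)%Z -> (p ^ v %| k`!)%N ->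
  (p%:Z ^+ v %| \prod_(i < k) (a - i%:Z * b))%Z.
Proof.
move=> pNb pv.
have cop : coprimez b (p%:Z ^+ v).
  rewrite coprimez_sym coprimezXl // coprimezE /= prime_coprime //.
have [[u w] /= uw] := coprimezP _ _ cop.
pose q := p%:Z ^+ v.
have q_neq0 : q != 0 by rewrite expf_neq0 // -lt0n prime_gt0.
have [N NE] : exists N : nat, N%:Z = ((u * a) %% q)%Z.
  exists `|((u * a) %% q)%Z|%N; rewrite gez0_abs ?modz_ge0 //.
have dvdN : (q %| a - b * N%:Z)%Z.
  have -> : a - b * N%:Z = a * w * q + b * (u * a - N%:Z).
    by rewrite -{1}[a]mulr1 -uw /q; ring.
  by rewrite rpredD ?dvdz_mull // -eqz_mod_dvd NE modz_mod.
have dvdB : (q %| \prod_(i < k) (a - i%:Z * b) - \prod_(i < k) (b * (N%:Z - i%:Z)))%Z.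
  elim: k {pv} => [|k IH]; first by rewrite !big_ord0 subrr.
  rewrite !big_ord_recr /=.
  move: IH; move: (\prod_(i < k) (a - _)) (\prod_(i < k) (b * _)) => P Q IH.
  have -> : P * (a - k%:Z * b) - Q * (b * (N%:Z - k%:Z)) =
    (a - k%:Z * b) * (P - Q) + Q * (a - b * N%:Z) by ring.
  by apply: rpredD; apply: dvdz_mull.
have -> : \prod_(i < k) (a - i%:Z * b) =
  (\prod_(i < k) (a - i%:Z * b) - \prod_(i < k) (b * (N%:Z - i%:Z))) +
   \prod_(i < k) (b * (N%:Z - i%:Z)) by rewrite subrK.
rewrite rpredD // big_split dvdz_mull //=.
have -> : \prod_(i < k) (N%:Z - i%:Z) = (N ^_ k)%:Z.
  elim: k {pv dvdB} => [|k IH]; first by rewrite big_ord0.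
  rewrite big_ord_recr /= IH ffactnSr PoszM.
  have [ltNk|lekN] := ltnP N k; first by rewrite ffact_small // !mul0r.
  by rewrite subzn.
by rewrite /q -bin_ffact PoszM dvdz_mull // dvdzE abszX.
Qed.

Lemma loc_int_gbinom beta k : loc_int p beta -> loc_int p (gbinom beta k).
Proof.
move=> [b [a [pNb ba]]].
have := @dvd_falling a b k (logn p k`!) pNb (pfactor_dvdnn _ _).
have [m cop_pm] := pfactor_coprime pr_p (fact_gt0 k).
move: (logn _ _) => v kE /dvdzP[z zE].
exists (b ^+ k * m%:Z), z; split.
  apply: NdvdzM; last by rewrite dvdzE /= -prime_coprime.
  elim: k {zE kE} => [|k IH]; last by rewrite exprS NdvdzM.
  by rewrite expr0 dvdzE /= dvdn1 neq_ltn prime_gt1 ?orbT.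
have prodE : b%:~R ^+ k * \prod_(i < k) (beta - i%:R) = (z * p%:Z ^+ v)%:~R.
  rewrite -zE rmorph_prod /= -[in b%:~R ^+ k](card_ord k) -prodr_const -big_split /=.
  by apply: eq_bigr => i _; rewrite intrB intrM -ba /=; ring.
have k_neq0 : k`!%:R != 0 :> rat by rewrite pnatr_eq0 -lt0n fact_gt0.
rewrite /gbinom; apply: (mulIf k_neq0).
rewrite -mulrA divfK // intrM rmorphXn /= mulrAC prodE {1}kE natrM natrX intrM rmorphXn /=.
by ring.
Qed.

Lemma loc_mult_sum b (I : Type) (s : seq I) (P : pred I) (F : I -> rat) :
  (forall i, P i -> loc_mult p b (F i)) -> loc_mult p b (\sum_(i <- s | P i) F i).
Proof.
move=> multF; apply: big_ind => // [|_ _ [y int_y ->] [z int_z ->]].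
  by exists 0; [exact: (loc_int_int 0) | rewrite mul0r].
by exists (y + z); [exact: loc_intD | rewrite mulrDl].
Qed.

Lemma loc_multMl b x y : loc_int p x -> loc_mult p b y -> loc_mult p b (x * y).
Proof. by move=> int_x [z int_z ->]; exists (x * z); [exact: loc_intM | rewrite mulrA]. Qed.

Lemma loc_multB b x y : loc_mult p b x -> loc_mult p b y -> loc_mult p b (x - y).
Proof.
move=> [u int_u ->] [v int_v ->]; exists (u - v); last by rewrite mulrBl.
by apply: loc_intD => //; apply: loc_intN.
Qed.

Lemma loc_mult_int b y : loc_int p y -> loc_mult p b (b * y).
Proof. by move=> int_y; exists y; last exact: mulrC. Qed.

End LocInt.

(** * Coefficients of rational powers of the Euler product *)

Lemma qpoch_trunc_int m :
  qpoch_trunc m = map_poly intr (\prod_(1 <= i < m.+1) (1 - 'X^i) : {poly int}).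
Proof.
rewrite rmorph_prod; apply: eq_bigr => i _.
by rewrite rmorphB rmorph1 rmorphXn /= map_polyX.
Qed.

Lemma loc_int_pnat p beta n : prime p -> loc_int p beta -> loc_int p (pnat beta n).
Proof.
move=> pr_p int_beta; rewrite /Defs.pnat coef_sum; apply: loc_int_sum => // k _.
rewrite coefZ; apply: loc_intM => //; first exact: loc_int_gbinom.
have -> : (qpoch_trunc n - 1) ^+ k =
    map_poly intr ((\prod_(1 <= i < n.+1) (1 - 'X^i) - 1) ^+ k : {poly int}).
  by rewrite rmorphXn rmorphB rmorph1 /= -qpoch_trunc_int.
by rewrite coef_map; exact: loc_int_int.
Qed.

(** The differential equation (1 + u) G' = beta u' G of G = (1 + u)^beta, for the binomial
    series truncated after u^n; v stands for u'. *)
Lemma binomial_series_ode beta n (u v : {poly rat}) :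
  (u + 1) * (\sum_(k < n.+1) (k%:R * gbinom beta k) *: (u ^+ k.-1 * v)) =
  beta *: (v * \sum_(k < n.+1) gbinom beta k *: u ^+ k)
    - ((beta - n%:R) * gbinom beta n) *: (v * u ^+ n).
Proof.
elim: n => [|n IH].
  by rewrite !big_ord_recl !big_ord0 /gbinom big_ord0 -!mul_polyC /= polyCM; ring.
rewrite big_ord_recr [in RHS]big_ord_recr /= mulrDr IH gbinomS exprS -!mul_polyC.
have -> : ((beta - n%:R) * gbinom beta n)%:P = (n.+1%:R * gbinom beta n.+1)%:P :> {poly rat}.
  by rewrite gbinomS.
rewrite !polyCM !polyCB; ring.
Qed.

(** Coefficients of F G' = beta F' G, where F = (q;q)_oo and G = F^beta. The truncations
    contribute only in higher degrees, as F - 1 has no constant term. *)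
Lemma pnat_deriv beta n :
  \sum_(i < n.+1) (qpoch_trunc n.+1)`_i * ((n.+1 - i)%N%:R * pnat beta (n.+1 - i)) =
  beta * \sum_(i < n.+1) (i.+1%:R * (qpoch_trunc n.+1)`_i.+1) * pnat beta (n - i).
Proof.
set F := qpoch_trunc n.+1.
pose G := \sum_(k < n.+2) gbinom beta k *: (F - 1) ^+ k.
have pG i : (i <= n.+1)%N -> pnat beta i = G`_i by move=> le_in; rewrite (Defs.pnatE _ le_in).
transitivity (F * G^`())`_n.
  rewrite coefM; apply: eq_bigr => i _.
  have le_in : (i <= n)%N by rewrite -ltnS.
  by rewrite coef_deriv pG ?leq_subr // subSn // mulr_natl.
transitivity (beta *: (F^`() * G))`_n; last first.
  rewrite coefZ coefM; congr (_ * _); apply: eq_bigr => i _.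
  rewrite coef_deriv pG ?mulr_natl //.
  exact: leq_trans (leq_subr _ _) (leqnSn n).
have F'E : F^`() = (F - 1)^`() by rewrite derivB derivC subr0.
have -> : F * G^`() = beta *: (F^`() * G) -
    ((beta - n.+1%:R) * gbinom beta n.+1) *: (F^`() * (F - 1) ^+ n.+1).
  have uE : F = (F - 1) + 1 by rewrite subrK.
  rewrite F'E; move: (F - 1) @G {pG F'E} uE => u G ->.
  have -> : G^`() = \sum_(k < n.+2) (k%:R * gbinom beta k) *: (u ^+ k.-1 * u^`()).
    rewrite /G raddf_sum; apply: eq_bigr => k _ /=.
    by rewrite derivZ deriv_exp -scaler_nat scalerA [u^`() * _]mulrC [gbinom _ _ * _]mulrC.
  exact: binomial_series_ode.
rewrite coefB [X in _ - X]coefZ.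
have -> : (F^`() * (F - 1) ^+ n.+1)`_n = 0.
  rewrite coefM big1 // => i _; rewrite coef_qpoch_exp_gt ?mulr0 // ltnS leq_subr //.
by rewrite mulr0 subr0.
Qed.

(** The recurrence [pnat_deriv] expresses n g_n as a multiple of beta minus a combination
    of the k g_k with k < n. *)
Lemma loc_mult_n_pnat p beta n : prime p -> loc_int p beta ->
  loc_mult p beta (n%:R * pnat beta n).
Proof.
move=> pr_p int_beta; have [m lt_nm] := ubnP n.
elim: m n lt_nm => // m IH [|n] lt_nm.
  by exists 0; [exact: (loc_int_int pr_p 0) | rewrite !mul0r].
have intF i : loc_int p (qpoch_trunc n.+1)`_i.
  by rewrite qpoch_trunc_int coef_map; exact: loc_int_int.
have F0 : (qpoch_trunc n.+1)`_0 = 1.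
  have := coef_qpoch_exp 1 (leq0n n.+1); rewrite !expr1 !coefB => /addIr ->.
  by rewrite /qpoch_trunc big_geq // coef1.
(* The left side of the recurrence is the wanted term plus earlier ones. *)
have := pnat_deriv beta n; rewrite big_ord_recl /= F0 mul1r subn0.
move/(canRL (addrK _)) => ->; apply: loc_multB => //.
  apply: loc_mult_int; apply: loc_int_sum => // i _.
  apply: loc_intM => //; last exact: loc_int_pnat.
  by apply: loc_intM => //; exact: (loc_int_int pr_p i.+1).
apply: loc_mult_sum => // i _; apply: loc_multMl => //; apply: IH.
by move: lt_nm; rewrite /bump /=; clear; lia.
Qed.

(** In [loc_mult_n_pnat] the factor n contains p at most once. *)
Lemma loc_mult_p_pnat p beta n : prime p -> loc_int p beta -> ~~ (p ^ 2 %| n)%N ->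
  loc_mult p beta (p%:R * pnat beta n).
Proof.
move=> pr_p int_beta pNn.
have n_gt0 : (0 < n)%N by case: n pNn => //; rewrite dvdn0.
have [y int_y nE] := loc_mult_n_pnat n pr_p int_beta.
have [m cop_pm nm] := pfactor_coprime pr_p n_gt0.
have v_le1 : (logn p n <= 1)%N by rewrite -ltnS ltnNge -pfactor_dvdn.
exists (y * p%:R ^+ (1 - logn p n) / m%:R).
  apply: (@loc_int_div _ pr_p m); first by rewrite dvdzE /= -prime_coprime.
  have -> : m%:~R * (y * p%:R ^+ (1 - logn p n) / m%:R) = y * p%:R ^+ (1 - logn p n) :> rat.
    rewrite mulrC divfK // pnatr_eq0; apply: contraTneq cop_pm => ->.
    by rewrite /coprime gcdn0 neq_ltn prime_gt1 ?orbT.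
  apply: loc_intM => //; rewrite -natrX; exact: (loc_int_int pr_p (p ^ _)%N).
have m_neq0 : m%:R != 0 :> rat.
  by rewrite pnatr_eq0; apply: contraTneq n_gt0 => m0; rewrite nm m0.
apply: (mulIf m_neq0).
rewrite [RHS]mulrAC divfK // [RHS]mulrAC -nE [in n%:R]nm natrM natrX.
have -> : m%:R * p%:R ^+ logn p n * pnat beta n * p%:R ^+ (1 - logn p n) =
  p%:R ^+ (logn p n + (1 - logn p n)) * pnat beta n * m%:R by rewrite exprD; ring.
by rewrite subnKC // expr1.
Qed.

(** Clearing denominators gives an equation between products of integers, whose valuations
    can be compared term by term. *)
Lemma cong0_loc_mult p beta x : prime p -> loc_mult p beta (p%:R * x) ->
  cong0 p (padic_ord p beta - 1%:E)%E x.
Proof.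
move=> pr_p [y [d [z [pNd dy]]] xE]; rewrite /cong0 /padic_ord.
have [x0|x_neq0] := eqVneq x 0; first by rewrite leey.
have p_neq0 : p%:R != 0 :> rat by rewrite pnatr_eq0 -lt0n prime_gt0.
have /norP[y_neq0 beta_neq0] : ~~ ((y == 0) || (beta == 0)).
  by rewrite -mulf_eq0 -xE mulf_neq0.
rewrite (negbTE beta_neq0) -EFinB lee_fin.
have d_neq0 : d != 0 by apply: contraNneq pNd => ->; rewrite dvdz0.
have z_neq0 : z != 0.
  by rewrite -(intr_eq0 rat) -dy mulf_neq0 ?intr_eq0.
have : d * p%:Z * numq x * denq beta = z * numq beta * denq x.
  apply: (@intr_inj rat); rewrite !intrM !numqE -dy.
  rewrite (_ : _ * _ * _ * _ = d%:~R * (denq x)%:~R * (denq beta)%:~R * (p%:R * x)).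
    by rewrite xE; ring.
  by ring.
move/(congr1 (fun t => logn p `|t|%N)); rewrite !abszM.
have p_neq0Z : p%:Z != 0 by rewrite -lt0n prime_gt0.
have nat_gt0 (t : int) : t != 0 -> (0 < `|t|)%N by rewrite absz_gt0.
rewrite !lognM ?muln_gt0 ?nat_gt0 ?denq_neq0 ?numq_eq0 ?prime_gt0 //=.
rewrite (logn_prime _ pr_p) eqxx.
have -> : logn p `|d| = 0%N.
  by rewrite lognE; move: pNd; rewrite dvdzE /= => /negbTE ->; rewrite !andbF.
move: (logn _ _) (logn _ _) (logn _ _) (logn _ _) (logn _ _); lia.
Qed.

(** * The congruence *)

Lemma padic_ord1P p (m : int) : prime p -> padic_ord p m%:~R = 1%:E ->
  (p%:Z %| m)%Z /\ ~~ (p%:Z ^+ 2 %| m)%Z.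
Proof.
move=> pr_p; rewrite /padic_ord intr_eq0 numq_int denq_int logn1 subr0.
case: eqP => // /eqP m_neq0 [logm].
rewrite !dvdzE abszX /= pfactor_dvdn ?absz_gt0 // logm; split=> //.
by apply/negPn/negP => pNm; move: logm; rewrite lognE (negbTE pNm) !andbF.
Qed.

Unset Implicit Arguments.

Theorem theorem3 (ell : nat) (alpha : rat) (r n : int)
  (ell_prime : prime ell)
  (ell_satisfactory : ell <> 1 %[mod 12])
  (ell_denq : ~~ (ell%:Z %| denq alpha)%Z)
  (r_ord : padic_ord ell (12 * r + 1)%:~R = 1%:E) :
  cong0 ell (padic_ord ell (alpha - 2) - 1%:E)%E (palpha alpha (ell%:Z ^+ 2 * n + r)).
Proof.
have [ell_dvd ell2_Ndvd] := padic_ord1P ell_prime r_ord.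
case NE: (ell%:Z ^+ 2 * n + r) => [N|N]; last by rewrite /cong0 /padic_ord eqxx leey.
have int_beta : loc_int ell (alpha - 2).
  apply: loc_intD => //; first exact: loc_int_denq.
  exact: (loc_int_int ell_prime (-2)).
apply: cong0_loc_mult => //.
have -> : palpha alpha N%:Z = pnat (alpha - 2 + 2) N by rewrite subrK.
rewrite Defs.pnat_D mulr_sumr; apply: loc_mult_sum => // i _.
have [ell_i|ellN_i] := boolP (ell ^ 2 %| i)%N; last first.
  rewrite mulrA mulrC; apply: loc_multMl => //; last exact: loc_mult_p_pnat.
  by apply: loc_int_pnat => //; exact: (loc_int_int ell_prime 2).
(* In this case 12 (N - i) + 1 and 12 r + 1 agree modulo ell^2. *)
have [t NiE] : exists t : int,
    (12 * (N - i) + 1)%N%:Z = (12 * r + 1) + ell%:Z ^+ 2 * t.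
  have /dvdnP[j iE] := ell_i.
  exists (12 * (n - j%:Z)).
  have le_iN : (i <= N)%N by rewrite -ltnS.
  rewrite PoszD PoszM -subzn // -NE iE !PoszM.
  by ring.
rewrite (@pnat_2_vanish ell) ?mulr0 //.
- by exists 0; [exact: (loc_int_int ell_prime 0) | rewrite mul0r].
- rewrite -[(_ %| _)%N]/(ell%:Z %| (12 * (N - i) + 1)%N%:Z)%Z NiE rpredD //.
  by rewrite expr2 -mulrA dvdz_mulr.
have -> : (ell ^ 2 %| 12 * (N - i) + 1)%N = (ell%:Z ^+ 2 %| (12 * (N - i) + 1)%N%:Z)%Z.
  by rewrite dvdzE abszX.
apply: contra ell2_Ndvd => h; rewrite -[X in (_ %| X)%Z](addrK (ell%:Z ^+ 2 * t)) -NiE.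
by rewrite rpredB // dvdz_mulr.
Qed.
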